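(* Let $(X,\mathcal U)$ be a uniform space, let $f\in U(X)$ and let $g:\mathbb R\to\mathbb R$ be continuous. Suppose that for each $U\in\mathcal U$ there are $B\subset X$ and $n\in\mathbb N$ such that $f(B)$ is bounded and the composition $g\circ f$ is uniformly continuous on $X\setminus U^n[B]$. Then $g\circ f\in U(X)$.
   Context: Uniform spaces are Hausdorff, given by their filters $\mathcal U$ of entourages; all $U\in\mathcal U$ considered are assumed open and symmetric. $\mathbb N$ denotes the positive integers. $U(X)$ is the set of real-valued uniformly continuous functions on $X$. For $U\in\mathcal U$, $F\subset X$, $n\in\mathbb N$: $U^n=U\circ\cdots\circ U$ ($n$ times) and $U[F]=\{x\in X:(x,y)\in U\text{ for some }y\in F\}$. *)

(* Defs.v *)
From HB Require Import structures.
From mathcomp Require Import all_boot all_order all_algebra.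
From mathcomp Require Import all_classical all_reals all_analysis.

Set Implicit Arguments.
Unset Strict Implicit.
Unset Printing Implicit Defensive.

Import numFieldNormedType.Exports.

Local Open Scope classical_set_scope.
Local Open Scope relation_scope.

Definition rel_pow (X : Type) (U : set (X * X)) (n : nat) : set (X * X) :=
  iter n (fun V => U \; V) diagonal.

(* The point of F is the second component of the pair: this is not the forward
   image of F, although the two agree when U is symmetric. *)
Definition rel_nbhd (X : Type) (U : set (X * X)) (F : set X) : set X :=
  [set x | exists2 y, F y & U (x, y)].

Definition symmetric_rel (X : Type) (U : set (X * X)) : Prop := U^-1 = U.

(* The uniform structure of [subspace A] identifies the whole space with A
   together with isolated points, so uniform continuity on [subspace A] only
   constrains pairs of points of A. *)
Definition unif_continuous_on (X Y : uniformType) (A : set X) (h : X -> Y) :=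
  unif_continuous (h : subspace A -> Y).

(* Main.v *)
(* Choose an open symmetric entourage U with |f x - f y| <= 1 on U, and then B
   and n as in the hypothesis. On U^n[B] the function f is bounded by some C, and
   by compactness the continuous map g is uniformly continuous near [-C, C],
   even when only one of the two points lies in [-C, C]. Hence close pairs of
   points meeting U^n[B] are controlled by g and f, and the other close pairs lie
   in the complement of U^n[B]. *)

Require Import Defs.
From HB Require Import structures.
From mathcomp Require Import all_boot all_order all_algebra.
From mathcomp Require Import all_classical all_reals all_analysis.

Set Implicit Arguments.
Unset Strict Implicit.
Unset Printing Implicit Defensive.

Import numFieldNormedType.Exports.
Import Order.TTheory GRing.Theory Num.Theory.

Local Open Scope classical_set_scope.

(** If [(x, y)] is small enough, any [x'] near [x] and [y'] near [y] are joined by the chain [x'],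
    [x], [y], [y'], which stays within [E]. *)
Lemma entourage_interior (X : uniformType) (E : set (X * X)) :
  entourage E -> entourage E°.
Proof.
move=> entE; apply: filterS (entourage_split_ent (entourage_split_ent entE)).
move=> [x y] xy; set D := split_ent (split_ent E) in xy *.
have entD : entourage D by do 2 apply: entourage_split_ent.
exists (xsection (D^-1)%relation x, xsection (split_ent E) y) => /=.
  by split; apply: nbhs_entourage => //; exact: entourage_inv.
move=> [x' y'] [/= /xsectionP xx' /xsectionP yy'].
apply: (entourage_split y) => //.
by apply: (entourage_split x).
Qed.

Lemma open_symmetric_entourage (X : uniformType) (E : set (X * X)) :
  entourage E ->
  exists U, [/\ entourage U, open U, symmetric_rel U & U `<=` E].
Proof.
move=> entE; have entI := entourage_interior entE.
have swapC : continuous (fun p : X * X => (p.2, p.1)).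
  by move=> p; apply: cvg_pair; [exact: cvg_snd|exact: cvg_fst].
exists (E° `&` (E°)^-1%relation); split.
- exact: entourage_invI.
- apply: openI; first exact: open_interior.
  have /continuousP/(_ _ (open_interior E)) := swapC.
  by congr open; apply/seteqP; split=> -[].
- by apply/seteqP; split=> -[x y] [].
- by move=> p [/interior_subset].
Qed.

(** Both points of a close pair lie near one point of [K], where [h] is continuous in all of [X];
    hence [y] may leave [K]. *)
Lemma compact_unif_continuous (X Y : uniformType) (K : set X) (h : X -> Y) :
  compact K -> {in K, continuous h} ->
  forall E, entourage E -> exists2 D, entourage D &
    forall x y, K x -> D (x, y) -> E (h x, h y).
Proof.
move=> /compact_near_coveringP cK hC E entE.
(* The near covering property of K is applied to pairs of points filtered by the
   entourages; the powerset filter of the entourages would require X pointed. *)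
pose P (p : X * X) x := p.1 = x -> E (h x, h p.2).
suff : \forall p \near @entourage X, K `<=` P p.
  by move=> entP; exists [set p | K `<=` P p] => // x y Kx /(_ x Kx); exact.
apply: cK => x Kx.
pose E' := split_ent (E `&` E^-1)%relation.
have entE' : entourage E' by apply/entourage_split_ent/entourage_invI.
have : nbhs x (h @^-1` xsection (E' `&` E'^-1)%relation (h x)).
  by apply: hC; [exact: mem_set|apply: nbhs_entourage; exact: entourage_invI].
move=> /nbhsP[V entV Vh].
exists (xsection (split_ent V) x, split_ent V).
  by split; [exact: nbhs_entourage|exact: entourage_split_ent].
move=> [x' [z y]] [/= /xsectionP xx' zy]; rewrite /P /= => zx'; subst z.
have /xsectionP[_ hx'] : xsection (E' `&` E'^-1)%relation (h x) (h x').
  by apply: (Vh x'); apply/xsectionP; exact: split_ent_subset.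
have /xsectionP[hy _] : xsection (E' `&` E'^-1)%relation (h x) (h y).
  by apply: (Vh y); apply/xsectionP; exact: entourage_split xx' zy.
by have [] : (E `&` E^-1)%relation (h x', h y) by
  apply: (entourage_split (h x)) => //; exact: entourage_invI.
Qed.

Lemma rel_pow_dist (R : realType) (X : Type) (f : X -> R) (U : set (X * X)) :
  (forall x y, U (x, y) -> `|f x - f y| <= 1)%R ->
  forall n x y, rel_pow U n (x, y) -> (`|f x - f y| <= n%:R)%R.
Proof.
move=> fU; elim=> [|n IHn] x y; first by move=> /diagonalP ->; rewrite subrr normr0.
move=> [z /= /IHn xz /fU zy]; rewrite -natr1.
by rewrite (le_trans (ler_distD (f z) _ _))// lerD.
Qed.

Theorem proposition2p4 (R : realType) (X : uniformType)
  (hausX : hausdorff_space X)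
  (f : X -> R) (fU : unif_continuous f)
  (g : R -> R) (gC : continuous g)
  (H : forall U : set (X * X), entourage U -> open U -> symmetric_rel U ->
     exists (B : set X) (n : nat),
       [/\ (0 < n)%N, bounded_set (f @` B) &
           unif_continuous_on (~` rel_nbhd (rel_pow U n) B) (g \o f)]) :
  unif_continuous (g \o f).
Proof.
have [U [entU oU sU Uf]] := open_symmetric_entourage
  (fU _ (entourage_ball _ 1%:pos%R)).
have {}Uf x y : U (x, y) -> (`|f x - f y| <= 1)%R by move=> /Uf /ltW.
have [B [n [_ /pinfty_ex_gt0 [M _ fB] gfU]]] := H U entU oU sU.
set A := rel_nbhd _ B in gfU.
(* [M] bounds [f] on [B], and a chain of [n] steps in [U] changes [f] by at most [n]. *)
set C := (M + n%:R)%R.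
have fA x : A x -> `[(- C)%R, C] (f x).
  move=> [y By xy]; rewrite /= in_itv /= -ler_norml -[f x](subrK (f y)).
  rewrite (le_trans (ler_normD _ _))// addrC lerD//; last exact: rel_pow_dist xy.
  by apply: fB; exists y.
move=> E entE.
(* [E], and later [D], are symmetrised: the point of [A] may be the second of the pair. *)
have [D entD DE] := compact_unif_continuous (@segment_compact _ (- C)%R C)
  (fun x _ => gC x) (entourage_invI entE).
have [V entV VE] := gfU _ entE.
apply: filterS (filterI entV (fU _ (entourage_invI entD))).
move=> [x y] [Vxy [Dxy Dyx]] /=.
have [/fA Ax|nAx] := pselect (A x); first by have [] := DE _ _ Ax Dxy.
have [/fA Ay|nAy] := pselect (A y); first by have [] := DE _ _ Ay Dyx.
(* A subspace entourage holds the diagonal and the pairs of [V] inside the subspace; the second case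
   applies. *)
by apply: (VE (x, y)); right.
Qed.
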